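(* For any agent $k\in\mathcal{K}$, Problem 2 for agent $k$ (minimize $\mathcal{J}^k(\boldsymbol{\psi}^k)$ over $\boldsymbol{\psi}^k\in\Psi^k$) is equivalent to Problem 1 (minimize $\mathcal{J}(\boldsymbol{g})$ over $\boldsymbol{g}\in G$). That is, $\mathcal{J}^k(\boldsymbol{\psi}^k)=\mathcal{J}(\boldsymbol{g})$ whenever $\boldsymbol{\psi}^k\in\Psi^k$ and $\boldsymbol{g}\in G$ correspond to each other; every element of $\Psi^k$ has a corresponding element of $G$ and vice versa; and consequently a control policy $\boldsymbol{g}^*\in G$ corresponding to an optimal prescription strategy $\boldsymbol{\psi}^{*k}$ of Problem 2 is optimal in Problem 1.
   Context: Network. $\mathcal{K}=\{1,\ldots,K\}$ is the set of agents, the vertices of a strongly connected directed graph $(\mathcal{K},\mathcal{E})$. Each link $(k,j)\in\mathcal{E}$ has a delay $\delta^{[k,j]}\in\mathbb{N}$. The delay of a directed path is the sum of its link delays; $d^{[k,j]}$ is the minimum delay over all directed paths from $k$ to $j$, with $d^{[k,k]}=0$. The network is known to all agents and fixed in time. System. Time is $t\in\mathcal{T}=\{0,1,\ldots,T\}$. The state $X_t$ takes values in a finite set $\mathcal{X}$ and evolves as $X_{t+1}=f_t(X_t,U_t^{1:K},W_t)$; agent $k$ observes $Y_t^k=h_t^k(X_t,V_t^k)$ in a finite set $\mathcal{Y}^k$; $U_t^k$ is the control action of agent $k$, taking values in the set of feasible actions $\mathcal{U}_t^k$, contained in a finite set $\mathcal{U}^k$. The variables $X_0$, $W_t$, $V_t^k$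 ($t\in\mathcal{T}$, $k\in\mathcal{K}$) are mutually independent, finitely valued, with known distributions. At each time $t$ the system incurs the cost $c_t(X_t,U_t^{1:K})\in\mathbb{R}$. Equalities between random variables hold with probability 1. Memory and control policies. The memory of agent $k$ at time $t$ is the collection of (labelled) random variables $M_t^k=\{Y^j_{0:t-d^{[j,k]}},\,U^j_{0:t-d^{[j,k]}-1}: j\in\mathcal{K}\}$ (a range $a:b$ with $a>b$ is empty), with values in a finite set $\mathcal{M}_t^k$. A control policy is $\boldsymbol{g}=(\boldsymbol{g}^1,\ldots,\boldsymbol{g}^K)$, $\boldsymbol{g}^k=(g_0^k,\ldots,g_T^k)$, with $g_t^k:\mathcal{M}_t^k\to\mathcal{U}_t^k$ and $U_t^k=g_t^k(M_t^k)$; $G$ is the set of all feasible control policies. Prescriptions. For $k\in\mathcal{K}$ let $\mathcal{B}^k=\{j\in\mathcal{K}: j\ge k\}$. The accessible information of agent $k$ is $A_t^k=\bigcap_{i=1}^k M_t^i$ (the variables common to the memories of agents $1,\ldots,k$), with set of possible values $\mathcal{A}_t^k$. For $j\in\mathcal{B}^k$, the inaccessible information of agent $k$ with respect to $A_t^j$ is $L_t^{[k,j]}=M_t^k\setminus A_t^j$, with set of possible values $\mathcal{L}_t^{[k,j]}$; thus $M_t^k=\{L_t^{[k,j]},A_t^j\}$ is a partition of the memory. A prescription function of agent $k$ for agent $j$ is a function $\Gamma_t^{[k,j]}:\mathcal{L}_t^{[j,k]}\to\mathcal{U}_t^j$ if $j\notin\mathcal{B}^k$, and $\Gamma_t^{[k,j]}:\mathcal{L}_t^{[j,j]}\to\mathcal{U}_t^j$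 if $j\in\mathcal{B}^k$; the set of these functions is $\mathscr{G}_t^{[k,j]}$. It is generated by $\Gamma_t^{[k,j]}=\psi_t^{[k,j]}(A_t^k)$ if $j\notin\mathcal{B}^k$ and $\Gamma_t^{[k,j]}=\psi_t^{[k,j]}(A_t^j)$ if $j\in\mathcal{B}^k$, where $\psi_t^{[k,j]}$ is a map from $\mathcal{A}_t^k$ (resp. $\mathcal{A}_t^j$) to $\mathscr{G}_t^{[k,j]}$. The prescription strategy of agent $k$ is $\boldsymbol{\psi}^k=(\boldsymbol{\psi}^{[k,1]},\ldots,\boldsymbol{\psi}^{[k,K]})$, where $\boldsymbol{\psi}^{[k,j]}=(\psi_0^{[k,j]},\ldots,\psi_T^{[k,j]})$; $\Psi^k$ is the set of feasible prescription strategies of agent $k$. Correspondence. $\boldsymbol{\psi}^k\in\Psi^k$ and $\boldsymbol{g}\in G$ correspond to each other if they generate the same control actions of all agents: for all $t\in\mathcal{T}$ and $j\in\mathcal{K}$, $g_t^j(M_t^j)=\Gamma_t^{[k,j]}(L_t^{[j,k]})$ if $j\notin\mathcal{B}^k$ and $g_t^j(M_t^j)=\Gamma_t^{[k,j]}(L_t^{[j,j]})$ if $j\in\mathcal{B}^k$. Under a prescription strategy $\boldsymbol{\psi}^k$ the control actions $U_t^j$ are given by these right-hand sides. Problem 1: choose $\boldsymbol{g}\in G$ to minimize $\mathcal{J}(\boldsymbol{g})=\mathbb{E}^{\boldsymbol{g}}\big[\sum_{t=0}^T c_t(X_t,U_t^{1:K})\big]$. Problem 2 for agent $k$: choose $\boldsymbol{\psi}^k\in\Psi^k$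 to minimize $\mathcal{J}^k(\boldsymbol{\psi}^k)=\mathbb{E}^{\boldsymbol{\psi}^k}\big[\sum_{t=0}^T c_t\big(X_t,\Gamma_t^{[k,1]}(L_t^{[1,k]}),\ldots,\Gamma_t^{[k,k]}(L_t^{[k,k]}),\Gamma_t^{[k,k+1]}(L_t^{[k+1,k+1]}),\ldots,\Gamma_t^{[k,K]}(L_t^{[K,K]})\big)\big]$. Superscripts on $\mathbb{E}$ indicate the policy or strategy generating the control actions. *)

(* Defs.v *)
From mathcomp Require Import all_boot all_order all_algebra.
From mathcomp Require Import all_classical all_reals all_analysis.
Set Implicit Arguments.
Unset Strict Implicit.
Unset Printing Implicit Defensive.
Import Order.TTheory GRing.Theory Num.Theory.
Import numFieldNormedType.Exports.
Local Open Scope classical_set_scope.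
Local Open Scope ring_scope.

(* Agents 1, ..., K are represented by 'I_K = {0, ..., K-1} with its order. *)
Record network := Network {
  nb_agents : nat;
  link : rel 'I_nb_agents;
  link_delay : 'I_nb_agents -> 'I_nb_agents -> nat;  (* used on links only *)
  strongly_connected : forall i j, connect link i j }.

Definition agent (N : network) : finType := 'I_(nb_agents N).

Section MinDelay.
Context (N : network).
Implicit Types i j k : agent N.

(* Total delay of the path visiting k and then the vertices of p. *)
Fixpoint path_delay k (p : seq (agent N)) : nat :=
  if p is j :: p' then (link_delay k j + path_delay j p')%N else 0%N.

Definition is_path_delay k j (n : nat) : Prop :=
  exists p, [/\ path (@link N) k p, last k p = j & path_delay k p = n].

Lemma is_path_delay_ex k j : exists n, `[< is_path_delay k j n >].
Proof.
have /connectP [p kp ->] := strongly_connected k j.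
by exists (path_delay k p); apply/asboolP; exists p.
Qed.

(* The empty path is allowed, so that min_delay k k = 0. *)
Definition min_delay k j : nat := ex_minn (is_path_delay_ex k j).

Lemma min_delayxx k : min_delay k k = 0%N.
Proof.
rewrite /min_delay; case: ex_minnP => n _ /(_ 0%N).
by rewrite leqn0 => le0; apply/eqP/le0/asboolP; exists [::].
Qed.

End MinDelay.

(* Time ranges over {0, ..., T}; W_T and f_T are present but never used. *)
Definition time (T : nat) : finType := 'I_T.+1.

(* The measurability of a variable X valued in a finite type is that of the
   events X = x.  Mutual independence is the product rule for all choices of
   the sets of values; taking some of them full gives the product rule for
   subfamilies. *)
Record system (R : realType) (d : measure_display) (Omega : measurableType d)
    (P : probability Omega R) (N : network) (T : nat) := System {
  state : finType;
  observation : agent N -> finType;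
  control : agent N -> finType;
  feasible : time T -> forall k, {set control k};
  disturbance : time T -> finType;
  noise : time T -> agent N -> finType;
  dynamics : forall t, state -> (forall k, control k) -> disturbance t -> state;
  observe : forall t k, state -> noise t k -> observation k;
  cost : time T -> state -> (forall k, control k) -> R;
  init : Omega -> state;
  dist : Omega -> forall t, disturbance t;
  nois : Omega -> forall t k, noise t k;
  measurable_init : forall x, measurable [set o | init o = x];
  measurable_dist : forall t w, measurable [set o | dist o t = w];
  measurable_nois : forall t k v, measurable [set o | nois o t k = v];
  mutually_independent :
    forall (B0 : {set state}) (BW : forall t, {set disturbance t})
           (BV : forall t k, {set noise t k}),
    (P [set o | [/\ init o \in B0, forall t, dist o t \in BW t
                  & forall t k, nois o t k \in BV t k]] =
     P [set o | init o \in B0] *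
     \prod_(t : time T) P [set o | dist o t \in BW t] *
     \prod_(t : time T) \prod_(k : agent N) P [set o | nois o t k \in BV t k])%E
}.

Arguments dynamics {R d Omega P N T} s t.
Arguments observe {R d Omega P N T} s t k.
Arguments cost {R d Omega P N T} s t.

Section Control.
Context (R : realType) (d : measure_display) (Omega : measurableType d)
        (P : probability Omega R) (N : network) (T : nat) (S : system P N T).
Implicit Types (t s r : time T) (i j k : agent N) (o : Omega).

(* Collections of labelled random variables are sets of labels: inl (j, s) is
   the label of Y_s^j and inr (j, s) the label of U_s^j. *)
Definition label : finType :=
  ((agent N * time T) + (agent N * time T))%type.

Definition act t k : finType := {u : control S k | u \in feasible S t k}.

Definition label_value (l : label) : finType :=
  match l with
  | inl (j, _) => observation S j
  | inr (j, s) => act s j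
  end.

(* Joint values of a collection of variables: past actions range over the
   feasible actions of their own time. *)
Definition values (C : {set label}) : finType :=
  {dffun forall l : {l : label | l \in C}, label_value (val l)}.

Definition restrict (C D : {set label}) (sCD : C \subset D) (m : values D) :
    values C :=
  [ffun l : {l : label | l \in C} =>
     m (exist _ (val l) (fintype.subsetP sCD _ (valP l)))].

(* The ranges s <= t - d and s <= t - d - 1 are written without truncated
   subtraction. *)
Definition memory t k : {set label} :=
  [set l : label | match l with
    | inl (j, s) => (s + min_delay j k <= t)%N
    | inr (j, s) => (s + min_delay j k < t)%N
    end].

Definition later_agents k : {set agent N} := [set j : agent N | (k <= j)%N].

Definition accessible t k : {set label} :=
  (\bigcap_(i : agent N | (i <= k)%N) memory t i)%SET.

Definition inaccessible t k j : {set label} := memory t k :\: accessible t j.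

(* All the observations up to t and all the actions before t. *)
Definition past t : {set label} :=
  [set l : label | match l with
    | inl (_, s) => (s <= t)%N
    | inr (_, s) => (s < t)%N
    end].

Lemma memory_past t k : memory t k \subset past t.
Proof.
apply/fintype.subsetP => -[[j s]|[j s]]; rewrite !inE.
- by apply: leq_trans; rewrite leq_addr.
- by apply: leq_ltn_trans; rewrite leq_addr.
Qed.

Lemma accessible_past t k : accessible t k \subset past t.
Proof.
apply: fintype.subset_trans (memory_past t k).
exact: (finset.bigcap_inf k).
Qed.

Lemma inaccessible_past t k j : inaccessible t k j \subset past t.
Proof. exact: fintype.subset_trans (subsetDl _ _) (memory_past t k). Qed.

Definition policy : Type := forall t k, values (memory t k) -> act t k.

(* The agent with respect to whose accessible information agent k prescribes
   the action of agent j. *)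
Definition ref k j : agent N := if j \in later_agents k then j else k.

Definition prescription t k j : Type :=
  values (inaccessible t j (ref k j)) -> act t j.

Definition strategy k : Type :=
  forall t j, values (accessible t (ref k j)) -> prescription t k j.

(* A law gives the actions at time t as a function of the past realization;
   policies and prescription strategies are run through the laws below. *)
Definition law : Type := forall t, values (past t) -> forall j, act t j.

Definition policy_law (g : policy) : law := fun t h j =>
  g t j (restrict (memory_past t j) h).

(* Gamma_t^[k,j], as generated by psi from the past realization. *)
Definition gamma k (psi : strategy k) t (h : values (past t)) j :
    prescription t k j :=
  psi t j (restrict (accessible_past t (ref k j)) h).

Definition strategy_law k (psi : strategy k) : law := fun t h j =>
  gamma psi h (restrict (inaccessible_past t j (ref k j)) h).

(* Actions of all agents at the times before n. *)
Definition prefix (n : nat) : Type := forall s, (s < n)%N -> forall j, act s j.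

Definition prefixW (m n : nat) (lemn : (m <= n)%N) (u : prefix n) : prefix m :=
  fun s lt_sm => u s (leq_trans lt_sm lemn).

Fixpoint state_after o (n : nat) : (n < T.+1)%N -> prefix n -> state S :=
  match n return (n < T.+1)%N -> prefix n -> state S with
  | 0 => fun _ _ => init S o
  | m.+1 => fun lt_mT u =>
      let t : time T := Ordinal (ltnW lt_mT) in
      dynamics S t (state_after o (ltnW lt_mT) (prefixW (leqnSn m) u))
        (fun j => val (u t (ltnSn m) j)) (dist S o t)
  end.

Definition observation_after o s (u : prefix s) j : observation S j :=
  observe S s j (state_after o (ltn_ord s) u) (nois S o s j).

Lemma past_obs t j s : inl (j, s) \in past t -> (s <= t)%N.
Proof. by rewrite inE. Qed.

Lemma past_act t j s : inr (j, s) \in past t -> (s < t)%N.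
Proof. by rewrite inE. Qed.

Definition past_value o t (u : prefix t) (l : label) :
    l \in past t -> label_value l :=
  match l return l \in past t -> label_value l with
  | inl (j, s) => fun lt => observation_after o (prefixW (past_obs lt) u) j
  | inr (j, s) => fun lt => u s (past_act lt) j
  end.

Definition past_values o t (u : prefix t) : values (past t) :=
  [ffun l : {l : label | l \in past t} => past_value o u (valP l)].

Lemma prefix0 : prefix 0. Proof. by []. Qed.

Fixpoint run (phi : law) o (n : nat) : prefix n :=
  match n return prefix n with
  | 0 => prefix0
  | m.+1 => fun t lt_tm j =>
      phi t (past_values o (prefixW (lt_tm : (t <= m)%N) (@run phi o m))) j
  end.
Arguments run phi o n [s] _ j : rename.

(* X_t, Y_t^j, the realization of the variables in past t, and U_t^j, when the
   actions are generated by phi. *)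
Definition X (phi : law) t o : state S :=
  state_after o (ltn_ord t) (run phi o t).
Definition Y (phi : law) t o j : observation S j :=
  observe S t j (X phi t o) (nois S o t j).
Definition H (phi : law) t o : values (past t) :=
  past_values o (run phi o t).
Definition U (phi : law) t o j : act t j := phi t (H phi t o) j.

Lemma runE (phi : law) o n s (lt_sn : (s < n)%N) j :
  run phi o n lt_sn j = U phi s o j.
Proof.
elim/ltn_ind: n => -[//|n] IHn in s lt_sn j *.
rewrite /= /U /H; congr (phi s (past_values _ _) j).
apply: functional_extensionality_dep => r.
apply: functional_extensionality_dep => lt_rs.
apply: functional_extensionality_dep => i.
by rewrite /prefixW IHn // IHn.
Qed.

Lemma prefix_run (phi : law) o (m n : nat) (le_mn : (m <= n)%N) :
  prefixW le_mn (run phi o n) = run phi o m.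
Proof.
apply: functional_extensionality_dep => r.
apply: functional_extensionality_dep => lt_rm.
by apply: functional_extensionality_dep => i; rewrite /prefixW !runE.
Qed.

(* The recursion satisfies the equations of the closed loop. *)
Lemma X0E (phi : law) o : X phi ord0 o = init S o.
Proof. by []. Qed.

Lemma XSE (phi : law) o (n : nat) (lt_n : (n < T.+1)%N)
    (lt_n1 : (n.+1 < T.+1)%N) (t : time T := Ordinal lt_n) :
  X phi (Ordinal lt_n1) o =
  dynamics S t (X phi t o) (fun j => val (U phi t o j)) (dist S o t).
Proof.
rewrite /t {t} (bool_irrelevance lt_n (ltnW lt_n1)) /X.
set t := Ordinal (ltnW lt_n1).
rewrite (bool_irrelevance (ltn_ord t) (ltnW lt_n1 : (t < T.+1)%N)).
rewrite (bool_irrelevance (ltn_ord (Ordinal lt_n1)) lt_n1).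
rewrite -(prefix_run _ _ (leqnSn t)) -[LHS]/(dynamics S t _ _ _).
congr (dynamics _ _ _ _); apply: functional_extensionality_dep => j.
exact: congr1 (runE phi o (ltnSn n : (t < n.+1)%N) j).
Qed.

Lemma H_obsE (phi : law) o t j s (lts : inl (j, s) \in past t) :
  H phi t o (exist _ (inl (j, s)) lts) = Y phi s o j.
Proof.
by rewrite ffunE /= /observation_after prefix_run.
Qed.

Lemma H_actE (phi : law) o t j s (lts : inr (j, s) \in past t) :
  H phi t o (exist _ (inr (j, s)) lts) = U phi s o j.
Proof. by rewrite ffunE /= runE. Qed.

(* On each side the arguments are realized in the closed loop of that side: the
   memory of j under g, the variables A and L under psi. *)
Definition correspond k (psi : strategy k) (g : policy) : Prop :=
  forall t j, {ae P, forall o,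
    g t j (restrict (memory_past t j) (H (policy_law g) t o)) =
    gamma psi (H (strategy_law psi) t o)
      (restrict (inaccessible_past t j (ref k j)) (H (strategy_law psi) t o))}.

Definition policy_cost (g : policy) : \bar R :=
  'E_P[fun o => \sum_(t : time T)
    cost S t (X (policy_law g) t o) (fun j => val (U (policy_law g) t o j))].

Definition strategy_cost k (psi : strategy k) : \bar R :=
  'E_P[fun o => \sum_(t : time T)
    cost S t (X (strategy_law psi) t o) (fun j => val
      (gamma psi (H (strategy_law psi) t o)
        (restrict (inaccessible_past t j (ref k j))
          (H (strategy_law psi) t o))))].

Definition optimal_policy (g : policy) : Prop :=
  forall g' : policy, (policy_cost g <= policy_cost g')%E.

Definition optimal_strategy k (psi : strategy k) : Prop :=
  forall psi' : strategy k, (strategy_cost psi <= strategy_cost psi')%E.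

End Control.

(* Main.v *)
From Pilot Require Import Defs.
From mathcomp Require Import all_boot all_order all_algebra.
From mathcomp Require Import all_classical all_reals all_analysis.
From mathcomp Require Import measurable_realfun.

(** Both a policy and a prescription strategy are run through the same closed
loop, once each is turned into a law giving the actions as a function of the
past.  The information accessible to the prescribing agent is contained in the
memory of the agent that acts, so that this memory splits into an accessible
and an inaccessible part.  A policy and a strategy are therefore the two
curried forms of one function: applying a strategy to both parts of the memory
gives a policy ([policy_of]), gluing the two parts back together turns a policy
into a strategy ([strategy_of]), and neither operation changes the law.  Equal
laws make the correspondence hold surely, which gives corresponding elements in
both directions.

Conversely, a policy and a strategy that are only known to correspond generate
the same actions almost surely in their respective closed loops.  On each such
outcome the actions determine the states, hence the two total costs agree
([eq_total_cost]).  For the expectations to agree, the total costs must also be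
measurable, which holds because they factor through the finitely many values of
the primitive random variables ([measurable_total_cost]).

The transfer of optimality follows: the cost of any competing policy is the
cost of a strategy, which is at least the cost of the optimal one. *)

Set Implicit Arguments.
Unset Strict Implicit.
Unset Printing Implicit Defensive.
Import Order.TTheory GRing.Theory Num.Theory.
Local Open Scope classical_set_scope.
Local Open Scope ring_scope.

Section PrescriptionsAndPolicies.
(* [restrict] is the restriction of joint values, not its homonym on functions. *)
Import Pilot.Defs.
Context (R : realType) (d : measure_display) (Omega : measurableType d)
        (P : probability Omega R) (N : network) (T : nat) (S : system P N T).
Implicit Types (t s : time T) (i j k : agent N) (o : Omega).
Implicit Types (A C D : {set label N T}).

Lemma restrict_comp A C D (sAC : A \subset C) (sCD : C \subset D)
    (sAD : A \subset D) (m : values S D) :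
  restrict sAC (restrict sCD m) = restrict sAD m.
Proof.
apply/ffunP => -[l lA]; rewrite !ffunE /=.
by congr (m (exist _ l _)); exact: bool_irrelevance.
Qed.

(** This undoes the splitting of a collection into the variables of [A] and the
remaining ones.  Membership is decided as a [sumbool], whose case analysis
leaves the membership proofs inside the labels untouched. *)
Definition glue C A (a : values S A) (b : values S (C :\: A)) : values S C :=
  [ffun l : {l : label N T | l \in C} =>
     match decP (@idP (val l \in A)) with
     | left lA => a (exist _ (val l) lA)
     | right lNA =>
         b (exist _ (val l)
           (introT setDP (conj (valP l) (introN idP lNA))))
     end].

Lemma glue_restrict C A D (sAD : A \subset D) (sBD : C :\: A \subset D)
    (sCD : C \subset D) (m : values S D) :
  glue (restrict sAD m) (restrict sBD m) = restrict sCD m.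
Proof.
apply/ffunP => -[l lC]; rewrite !ffunE /=.
case: decP => lA; rewrite ffunE /=;
by congr (m (exist _ l _)); exact: bool_irrelevance.
Qed.

(** The memory of [j] is one of those intersected: the index of [ref k j] is the
larger of those of [j] and [k]. *)
Lemma accessible_memory t j k : accessible t (ref k j) \subset memory t j.
Proof.
apply: (finset.bigcap_inf j); rewrite /ref inE.
by case: ifP => // /negbT; rewrite -ltnNge => /ltnW.
Qed.

Definition policy_of k (psi : strategy S k) : policy S := fun t j m =>
  psi t j (restrict (accessible_memory t j k) m) (restrict (subsetDl _ _) m).

Definition strategy_of k (g : policy S) : strategy S k := fun t j a b =>
  g t j (glue a b).

Lemma law_ext (phi phi' : law S) :
  (forall t h j, phi t h j = phi' t h j) -> phi = phi'.
Proof.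
move=> e; apply: functional_extensionality_dep => t.
apply: functional_extensionality_dep => h.
by apply: functional_extensionality_dep => j.
Qed.

Lemma policy_of_law k (psi : strategy S k) :
  policy_law (policy_of psi) = strategy_law psi.
Proof.
apply: law_ext => t h j; rewrite /policy_law /policy_of.
by rewrite !(restrict_comp _ _ (accessible_past t (ref k j)))
  (restrict_comp _ _ (inaccessible_past t j (ref k j))).
Qed.

Lemma strategy_of_law k (g : policy S) :
  strategy_law (strategy_of g : strategy S k) = policy_law g.
Proof.
apply: law_ext => t h j; rewrite /strategy_law /gamma /strategy_of.
by rewrite (glue_restrict _ _ (memory_past t j)).
Qed.

(** The correspondence compares two different closed loops; when the laws are
equal these are the same loop. *)
Lemma correspond_law k (psi : strategy S k) (g : policy S) :
  policy_law g = strategy_law psi -> correspond psi g.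
Proof.
move=> e t j; apply: aeW => o.
by rewrite -[LHS]/(U (policy_law g) t o j) e.
Qed.

Definition total_cost (phi : law S) o : R :=
  \sum_(t : time T) cost S t (X phi t o) (fun j => val (U phi t o j)).

(** The primitive random variables being fixed by the outcome, the states are
functions of the actions alone. *)
Lemma eq_total_cost (phi phi' : law S) o :
  (forall t j, U phi t o j = U phi' t o j) ->
  total_cost phi o = total_cost phi' o.
Proof.
move=> eU; apply: eq_bigr => t _; congr (cost S t _ _).
- congr state_after; apply: functional_extensionality_dep => s.
  apply: functional_extensionality_dep => lt_st.
  by apply: functional_extensionality_dep => j; rewrite !runE.
- by apply: functional_extensionality_dep => j; rewrite eU.
Qed.

(** The primitive random variables are the initial state, the disturbances and
the noises, as opposed to those generated by the closed loop. *)
Definition same_primitives o o' : Prop :=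
  [/\ init S o = init S o', dist S o = dist S o' & nois S o = nois S o'].

Lemma state_after_primitives o o' : same_primitives o o' ->
  forall n (lt_nT : (n < T.+1)%N) u,
  state_after o lt_nT u = state_after (S := S) o' lt_nT u.
Proof.
case=> e0 eW _; elim=> [|n IHn] lt_nT u //=.
by rewrite IHn eW.
Qed.

Lemma past_values_primitives o o' t u : same_primitives o o' ->
  past_values o u = past_values (S := S) (t := t) o' u.
Proof.
move=> oo'; apply/ffunP => -[[[j s]|[j s]] lt]; rewrite !ffunE //=.
by rewrite /observation_after (state_after_primitives oo'); case: oo' => _ _ ->.
Qed.

Lemma run_primitives (phi : law S) o o' n : same_primitives o o' ->
  run phi o (n := n) = run phi o' (n := n).
Proof.
move=> oo'; elim: n => //= n ->.
apply: functional_extensionality_dep => t.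
apply: functional_extensionality_dep => lt_tn.
by rewrite (past_values_primitives _ oo').
Qed.

Lemma total_cost_primitives (phi : law S) o o' : same_primitives o o' ->
  total_cost phi o = total_cost phi o'.
Proof.
move=> oo'; apply: eq_bigr => t _.
by rewrite /X /U /H (run_primitives phi _ oo') (state_after_primitives oo')
  (past_values_primitives _ oo').
Qed.

(** The noises are indexed by pairs so that their joint values form a single
finite dependent function space. *)
Definition primitive_value : finType :=
  (state S * {dffun forall t : time T, disturbance S t} *
   {dffun forall tk : time T * agent N, noise S tk.1 tk.2})%type.

Definition primitives o : primitive_value :=
  (init S o, [ffun t => dist S o t], [ffun tk => nois S o tk.1 tk.2]).

Lemma measurable_primitives (q : primitive_value) :
  measurable [set o | primitives o = q].
Proof.
case: q => [[x w] v].
have -> : [set o | primitives o = (x, w, v)] =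
  [set o | init S o = x] `&`
  \bigcap_(t in [set: time T]) [set o | dist S o t = w t] `&`
  \bigcap_(tk in [set: time T * agent N]) [set o | nois S o tk.1 tk.2 = v tk].
  apply/seteqP; split=> [ o [ <- <- <-]|o [[/= ex ew] ev]].
    by split; [split|] => //= tk _; rewrite /= ffunE.
  congr (_, _, _) => //; apply/ffunP => tk; rewrite ffunE;
  [exact: ew | exact: ev].
apply: measurableI; first apply: measurableI.
- exact: measurable_init.
- apply: fin_bigcap_measurable => // t _; exact: measurable_dist.
- apply: fin_bigcap_measurable => // tk _; exact: measurable_nois.
Qed.

(** Every preimage is a union of atoms [primitives o = q], of which there are
finitely many, because the total cost is constant on each of them. *)
Lemma measurable_total_cost (phi : law S) :
  measurable_fun setT (total_cost phi).
Proof.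
move=> _ B _; rewrite setTI.
have -> : total_cost phi @^-1` B =
  \bigcup_(q in [set primitives o | o in total_cost phi @^-1` B])
    [set o | primitives o = q].
  apply/seteqP; split=> [ o Bo|o [_ [ o' Bo' <-] /= [e0 eW eV]]].
    by exists (primitives o) => //; exists o.
  rewrite /preimage /= (total_cost_primitives phi (o' := o')) //.
  split=> //; apply: functional_extensionality_dep => t.
    by move/ffunP/(_ t): eW; rewrite !ffunE.
  apply: functional_extensionality_dep => k.
  by move/ffunP/(_ (t, k)): eV; rewrite !ffunE.
apply: fin_bigcup_measurable => // q _; exact: measurable_primitives.
Qed.

(** The exceptional null sets depend on the time and the agent; there are
finitely many of these, so almost surely all the actions agree at once. *)
Lemma cost_correspond k (psi : strategy S k) (g : policy S) :
  correspond psi g -> strategy_cost psi = policy_cost g.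
Proof.
move=> psi_g.
rewrite -[LHS]/('E_P[total_cost (strategy_law psi)])%E.
rewrite -[RHS]/('E_P[total_cost (policy_law g)])%E.
rewrite unlock; apply: ae_eq_integral => //.
- by apply/measurable_EFinP; exact: measurable_total_cost.
- by apply/measurable_EFinP; exact: measurable_total_cost.
have : {ae P, forall o, forall t j,
    U (policy_law g) t o j = U (strategy_law psi) t o j}.
  apply: filter_forall => t; apply: filter_forall => j; exact: psi_g.
apply: filterS => o eU _ /=; congr EFin.
by apply: eq_total_cost => t j; rewrite eU.
Qed.

End PrescriptionsAndPolicies.

Theorem lemma5 (R : realType) (d : measure_display) (Omega : measurableType d)
    (P : probability Omega R) (N : network) (T : nat) (S : system P N T)
    (k : agent N) :
  [/\ (forall (psi : strategy S k) (g : policy S),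
         correspond psi g -> strategy_cost psi = policy_cost g),
      (forall psi : strategy S k, exists g : policy S, correspond psi g),
      (forall g : policy S, exists psi : strategy S k, correspond psi g)
    & (forall (psi : strategy S k) (g : policy S),
         optimal_strategy psi -> correspond psi g -> optimal_policy g)].
Proof.
have strategy_ex (g : policy S) : exists psi : strategy S k, correspond psi g.
  by exists (strategy_of g); apply/correspond_law/esym/strategy_of_law.
split=> //.
- exact: cost_correspond.
- by move=> psi; exists (policy_of psi); apply/correspond_law/policy_of_law.
- move=> psi g psi_opt psi_g g'; have [psi' psi'_g'] := strategy_ex g'.
  by rewrite -(cost_correspond psi_g) -(cost_correspond psi'_g').
Qed.
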